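(* Let $K,n$ be positive integers and let $G$ be a group having a $K$-approximate subgroup $A$ such that $|a^G|\leq n$ for each $a\in A$. Then the commutator subgroup of $\langle A^G\rangle$ has finite $(K,n)$-bounded order; that is, there is a function $f$ of two positive integer variables (independent of $G$ and $A$) such that for all such $K,n,G,A$ the commutator subgroup of $\langle A^G\rangle$ is finite of order at most $f(K,n)$.
   Context: A subset $A$ of a group $G$ is symmetric if $A=A^{-1}$. For a positive integer $K$, a symmetric subset $A$ of a group $G$ is a $K$-approximate subgroup if there is a finite subset $E\subseteq G$ such that $|E|\leq K$ and $AA\subseteq EA$, where $AA=\{ab: a,b\in A\}$ and $EA=\{ea: e\in E, a\in A\}$. The group $G$ and the set $A$ may be infinite. For $x\in G$, $x^G$ denotes the conjugacy class of $x$ in $G$. $A^G$ is the set of all conjugates $a^g=g^{-1}ag$ with $a\in A$, $g\in G$, and $\langle A^G\rangle$ is the subgroup it generates, i.e. the smallest normal subgroup of $G$ containing $A$. *)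

(* Defs.v *)
From HB Require Import structures.
From mathcomp Require Import all_boot.
From mathcomp Require Import boolp classical_sets functions cardinality.

Set Implicit Arguments.
Unset Strict Implicit.
Unset Printing Implicit Defensive.

Local Open Scope classical_set_scope.
Local Open Scope group_scope.

(* Groups are of type [groupType] and may be infinite; their subsets are classical
   sets.  "X is finite with |X| <= m" is written [(X #<= `I_m)%card]. *)

Section GroupSubsets.
Variable G : groupType.
Implicit Types (x : G) (A B H X : set G).

Definition set_inv A : set G := [set a^-1 | a in A].

Definition set_mul A B : set G := [set a * b | a in A & b in B].

Definition symmetric_subset A : Prop := A = set_inv A.

Definition approximate_subgroup (K : nat) A : Prop :=
  symmetric_subset A /\
  exists E : set G,
    (E #<= `I_K)%card /\ set_mul A A `<=` set_mul E A.

(* [x ^ g] is the library's conjugate g^-1 * (x * g). *)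
Definition conj_class x : set G := [set x ^ g | g in [set: G]].

Definition conjugates A : set G := [set a ^ g | a in A & g in [set: G]].

Definition is_subgroup H : Prop := group_closed (mem H).

Definition generated X : set G := smallest is_subgroup X.

(* [[~ x, y]] is the library's commutator x^-1 * y^-1 * x * y. *)
Definition commutator_subgroup H : set G :=
  generated [set [~ x, y] | x in H & y in H].

End GroupSubsets.

(* Main.v *)
(* Write A A inside E A with E chosen among elements of A A A.  Every element of
   the subgroup K = <A> lies in <E> a with a in A or a = 1, so its conjugate by h
   depends only on a^h and on the e^h with e in E; hence conjugacy classes of
   elements of K have bounded size, and A may be replaced by the subgroup K.

   Let X be the union of the G-classes meeting K.  A maximality argument in the
   style of B. H. Neumann and Wiegold shows that S = {[x, z] : x, z in X} has
   bounded size, and S generates the commutator subgroup of <X>.  Each [x, z] has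
   bounded order, because the center of <x, z> has bounded index (Schur's theorem,
   proved as by Rosenlicht).  Finally, a finite set of elements of finite order that
   is closed under conjugation generates a finite group (Dietzmann's lemma). *)
Require Import Defs.
From mathcomp Require Import all_boot.
From mathcomp Require Import boolp classical_sets functions cardinality.
From mathcomp Require Import zify.

Set Implicit Arguments.
Unset Strict Implicit.
Unset Printing Implicit Defensive.

Local Open Scope classical_set_scope.
Local Open Scope group_scope.

(** * Counting with covering lists *)

(** The list may repeat elements and leave [P], so bounds pass to subsets and images by plain list
    operations. *)
Definition bounded (T : eqType) (m : nat) (P : set T) : Prop :=
  exists s : seq T, size s <= m /\ forall x, P x -> x \in s.

Lemma bounded_card_le (T : choiceType) m (P : set T) :
  bounded m P <-> (P #<= `I_m)%card.
Proof.
split=> [[s [sm Ps]]|Pm].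
  apply/pcard_leP/injfunPex; exists (index^~ s) => [x /Ps xs|x y].
    by rewrite /= (leq_trans _ sm)// index_mem.
  by move=> /set_mem /Ps xs /set_mem /Ps ys /(congr1 (nth x s)); rewrite !nth_index.
exists (finmap.enum_fset (fset_set P)); split; first exact: geq_card_fset_set.
by move=> x Px; rewrite in_fset_set ?inE//; exact: card_le_finite Pm (finite_II _).
Qed.

Lemma bounded_sub (T : eqType) m (P Q : set T) :
  P `<=` Q -> bounded m Q -> bounded m P.
Proof. by move=> PQ [s [sm Qs]]; exists s; split=> // x /PQ /Qs. Qed.

Lemma bounded_leq (T : eqType) m k (P : set T) :
  m <= k -> bounded m P -> bounded k P.
Proof. by move=> mk [s [sm Ps]]; exists s; rewrite (leq_trans sm). Qed.

Lemma bounded_image (T U : eqType) (f : T -> U) m (P : set T) :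
  bounded m P -> bounded m [set f x | x in P].
Proof.
move=> [s [sm Ps]]; exists (map f s); split; first by rewrite size_map.
by move=> _ [x Px <-]; rewrite map_f// Ps.
Qed.

Lemma bounded_image2 (T U V : eqType) (f : T -> U -> V) m k P Q :
  bounded m P -> bounded k Q -> bounded (m * k) [set f x y | x in P & y in Q].
Proof.
move=> [s [sm Ps]] [t [tk Qt]]; exists (allpairs f s t).
rewrite size_allpairs leq_mul//; split=> // _ [x Px [y Qy <-]].
by apply/allpairsP; exists (x, y); rewrite Ps ?Qt.
Qed.

Lemma bounded_bigcup (I T : eqType) (r : seq I) m k (P : I -> set T) :
  size r <= m -> (forall i, i \in r -> bounded k (P i)) ->
  bounded (m * k) [set x | exists2 i, i \in r & P i x].
Proof.
elim: r m => [|i r IH] [|m]//= rm Pk; try by exists [::]; split=> // x [].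
have [s [sk Ps]] := Pk i (mem_head _ _).
have [|t [tk rt]] := IH m rm; first by move=> j jr; apply: Pk; rewrite inE jr orbT.
exists (s ++ t); rewrite size_cat mulSn leq_add//; split=> // x [j].
rewrite inE mem_cat => /predU1P[->|jr] Px; first by rewrite Ps.
by rewrite rt ?orbT//; exists j.
Qed.

Lemma bounded_reps (I T : eqType) (f : I -> T) m (P : set I) :
  bounded m [set f i | i in P] ->
  exists r : seq I, [/\ size r <= m, forall i, i \in r -> P i &
    forall i, P i -> exists2 j, j \in r & f i = f j].
Proof.
move=> [s [sm Ps]].
pose h t : option I :=
  if pselect (exists i, P i /\ f i = t) is left e then Some (projT1 (cid e)) else None.
exists (pmap h s); split.
- by rewrite size_pmap (leq_trans (count_size _ _)).
- move=> i; rewrite mem_pmap => /mapP[t _]; rewrite /h.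
  by case: pselect => // e [->]; case: cid => j [].
move=> i Pi; have: f i \in s by apply: Ps; exists i.
move=> fis; have: h (f i) \in map h s by apply: map_f.
rewrite {1}/h; case: pselect => [e|[]]; last by exists i.
by case: cid => /= j [Pj fj] js; exists j; rewrite ?mem_pmap.
Qed.

(** The main counting device: [f] records how finitely many elements are conjugated, and [g] is a
    conjugate or commutator determined by that record. *)
Lemma bounded_factor (I T U : eqType) (f : I -> T) (g : I -> U) m (P : set I) :
  (forall i j, P i -> P j -> f i = f j -> g i = g j) ->
  bounded m [set f i | i in P] -> bounded m [set g i | i in P].
Proof.
move=> fg /bounded_reps[r [rm rP Pr]]; exists (map g r); rewrite size_map.
split=> // _ [i Pi <-]; have [j jr fij] := Pr i Pi.
by apply/mapP; exists j => //; apply: fg => //; apply: rP.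
Qed.

Lemma bounded_map (I J T : eqType) (f : I -> J -> T) n (s : seq I) :
  (forall i, i \in s -> bounded n (range (f i))) ->
  bounded (n ^ size s) (range (fun j => [seq f i j | i <- s])).
Proof.
elim: s => [|i s IH] fn; first by exists [:: [::]]; split=> // _ [j _ <-].
have := @bounded_image2 _ _ _ cons _ _ _ _ (fn i (mem_head _ _))
  (IH (fun k ks => fn k (mem_behead (s := i :: s) ks))).
rewrite expnS; apply: bounded_sub => _ [j _ <-].
by exists (f i j); [exists j|exists [seq f k j | k <- s] => //; exists j].
Qed.

Lemma bounded_pigeonhole (T : eqType) (f : nat -> T) m :
  bounded m (range f) -> exists i j, [/\ i < j, j <= m & f i = f j].
Proof.
move=> [s [sm fs]]; have /(uniqPn (f 0)) : ~~ uniq (mkseq f m.+1).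
  apply/negP => /uniq_leq_size-/(_ s); rewrite size_mkseq ltnNge sm => sub.
  suff: false by []; apply: sub.
  by move=> _ /mapP[i _ ->]; apply: fs; exists i.
move=> [i [j [ij]]]; rewrite size_mkseq => jm.
by rewrite !nth_mkseq// ?(ltn_trans ij)// => fij; exists i, j.
Qed.

Section Groups.
Variable G : groupType.
Implicit Types (x y z a b c d g h p q u : G) (D K P X : set G) (s w : seq G).

Local Notation few n x := (bounded n (conj_class x)).

Lemma conj_eqP x g h : x ^ g = x ^ h <-> commute x (g * h^-1).
Proof.
split=> [xgh|/commgP].
  by apply/commgP; rewrite -conjg_fix conjgM xgh -conjgM mulgV conjg1.
by rewrite -conjg_fix conjgM => /eqP/(congr1 (conjg^~ h)); rewrite conjgKV.
Qed.

(** * Shortening words, for Dietzmann's lemma *)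

Section Shortening.
Variables (D : set G) (s0 : seq G) (e : nat).
Hypothesis Ds0 : forall x, D x -> x \in s0.
Hypothesis DJ : forall c d, D c -> D d -> D (c ^ d).

(** Pulling [c ^+ k] leftwards past [x] turns [x] into [x ^ (c ^+ k)], which stays in [D], so no
    letters are gained. *)
Lemma word_extract c k w : D c -> {in w, forall x, D x} -> k <= count_mem c w ->
  exists w', [/\ {in w', forall x, D x}, size w' + k = size w &
    \prod_(x <- w) x = c ^+ k * \prod_(x <- w') x].
Proof.
move=> Dc; elim: w k => [|x w IH] k Dw /=.
  by rewrite leqn0 => /eqP->; exists [::]; rewrite big_nil mulg1.
have Dx : D x by apply: Dw; rewrite mem_head.
have {}Dw : {in w, forall y, D y} by move=> y yw; apply: Dw; rewrite inE yw orbT.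
case: eqP => [->|_] kw.
  case: k kw => [_|k kw].
    by exists (c :: w); rewrite mul1g addn0; split=> // y /predU1P[->//|/Dw].
  have [w' [Dw' sw' pw]] := IH k Dw kw; exists w'; split=> //.
    by rewrite addnS sw'.
  by rewrite big_cons pw expgS mulgA.
have [w' [Dw' sw' pw]] := IH k Dw kw.
exists (x ^ (c ^+ k) :: w'); split; last 2 first.
- by rewrite /= addSn sw'.
- by rewrite !big_cons pw mulgA (conjgC x) -mulgA.
move=> y /predU1P[->|/Dw'//].
elim: (k) => [|i IHi]; first by rewrite conjg1.
by rewrite expgSr conjgM; apply: DJ.
Qed.

(** Order at most [e] implies this; the weaker form also covers commutators whose finite order is
    still to be proved. *)
Hypothesis Dpow : forall c, D c -> exists w,
  [/\ {in w, forall x, D x}, size w <= e & \prod_(x <- w) x = c ^+ e.+1].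

(* A word longer than [size s0 * e] repeats some letter c more than e times; these
   letters can be collected in front, and c ^+ e.+1 is replaced by a shorter word. *)
Lemma word_shorten w : {in w, forall x, D x} -> exists w',
  [/\ {in w', forall x, D x}, size w' <= size s0 * e &
    \prod_(x <- w') x = \prod_(x <- w) x].
Proof.
have [n] := ubnP (size w); elim: n w => // n IH w wn Dw.
have [wle|wgt] := leqP (size w) (size s0 * e); first by exists w.
have [c [Dc cw]] : exists c, D c /\ e < count_mem c w.
  have : has (fun c => e < count_mem c w) s0.
    apply/negPn/negP; rewrite -all_predC => /allP small.
    move: wgt; rewrite ltnNge => /negP; apply.
    have : {subset w <= s0} by move=> x /Dw /Ds0.
    elim: (s0) (w) small => [|c t IHt] v small vt.
      by case: v {small} vt => // x v /(_ x (mem_head _ _)).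
    rewrite mulSn -(count_predC (pred1 c)) leq_add//.
      by move: (small c (mem_head _ _)); rewrite /= -leqNgt.
    rewrite -size_filter; apply: IHt => x.
      move=> xt /=; rewrite -leqNgt count_filter.
      have := small x; rewrite inE xt orbT => /(_ isT) /=; rewrite -leqNgt.
      by apply: leq_trans; apply: sub_count => y /andP[].
    by rewrite mem_filter /= => /andP[xc /vt]; rewrite inE (negPf xc).
  move=> /hasP[c _ cw]; exists c; split=> //; apply: Dw.
  by rewrite -has_pred1 has_count (leq_ltn_trans _ cw).
have [w' [Dw' sw' pw]] := word_extract Dc Dw cw.
have [v [Dv sv pv]] := Dpow Dc.
have [||u [Du su pu]] := IH (v ++ w').
- by rewrite size_cat; lia.
- by move=> x; rewrite mem_cat => /orP[/Dv|/Dw'].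
by exists u; split=> //; rewrite pu big_cat /= pv pw.
Qed.

Lemma bounded_short_words n : bounded ((size s0).+1 ^ n)
  [set \prod_(x <- w) x | w in [set w | {in w, forall x, D x} /\ size w <= n]].
Proof.
elim: n => [|n IH].
  exists [:: 1]; split=> // _ [w [_ w0] <-].
  by move: w0; rewrite leqn0 => /nilP ->; rewrite big_nil mem_head.
have b1 : bounded (size s0).+1 [set x | x = 1 \/ D x].
  by exists (1 :: s0); split=> // x [->|/Ds0]; rewrite inE ?eqxx// => ->; rewrite orbT.
have := bounded_image2 (@mul G) b1 IH; rewrite -expnS.
apply: bounded_sub => _ [w [Dw wn] <-]; case: w Dw wn => [|x w] Dw wn.
  by exists 1; [left|exists 1; rewrite ?mul1g ?big_nil//; exists [::]; rewrite ?big_nil].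
exists x; first by right; apply: Dw; rewrite mem_head.
exists (\prod_(y <- w) y); last by rewrite big_cons.
by exists w => //; split=> // y yw; apply: Dw; rewrite inE yw orbT.
Qed.

End Shortening.

Lemma bounded_words D m e :
  bounded m D -> (forall c d, D c -> D d -> D (c ^ d)) ->
  (forall c, D c -> exists w,
    [/\ {in w, forall x, D x}, size w <= e & \prod_(x <- w) x = c ^+ e.+1]) ->
  bounded (m.+1 ^ (m * e))
    [set \prod_(x <- w) x | w in [set w | {in w, forall x, D x}]].
Proof.
move=> [s [sm Ds]] DJ Dpow.
apply: bounded_leq (_ : ((size s).+1 ^ (size s * e))%N <= _) _.
  apply: (@leq_trans (m.+1 ^ (size s * e))%N); last by rewrite leq_pexp2l// leq_mul.
  by case: (size s * e)%N => // k; rewrite leq_exp2r.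
apply: bounded_sub (bounded_short_words Ds _) => _ [w Dw <-].
by have [w' [Dw' sw' pw]] := word_shorten Ds DJ Dpow Dw; exists w'.
Qed.

(** * Double centralizers and torsion of commutators *)

Lemma prod_nseq k c : \prod_(x <- nseq k c) x = c ^+ k.
Proof. by rewrite big_nseq iter_mulg_1. Qed.

(** Stands in for the subgroup generated by [Y]: conjugation of its elements is determined by
    conjugation on [Y]. *)
Definition double_centralizer (Y : set G) : set G :=
  [set p | forall c, (forall y, Y y -> commute y c) -> commute p c].

Lemma double_centralizer_sub Y : Y `<=` double_centralizer Y.
Proof. by move=> y Yy c; apply. Qed.

Lemma double_centralizerM Y p q : double_centralizer Y p ->
  double_centralizer Y q -> double_centralizer Y (p * q).
Proof.
move=> Yp Yq c Yc; apply/commute_sym/commuteM; apply/commute_sym.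
  exact: Yp.
exact: Yq.
Qed.

Lemma double_centralizerV Y p :
  double_centralizer Y p -> double_centralizer Y p^-1.
Proof. by move=> Yp c Yc; apply/commute_sym/commuteV/commute_sym/Yp. Qed.

Lemma double_centralizer_conj Y p g h :
  (forall y, Y y -> y ^ g = y ^ h) -> double_centralizer Y p -> p ^ g = p ^ h.
Proof. by move=> Ygh Yp; apply/conj_eqP/Yp => y /Ygh/conj_eqP. Qed.

(** The bound of [bounded_words] with [e = n * n]: at most [n * n] pairs [(x ^ g, z ^ g)], and the
    square of that many commutators. *)
Definition torsion_bound n := ((n * n * (n * n)).+1 ^ (n * n * (n * n) * (n * n)))%N.

(** With [c = [~ p, q]], [[~ p, q * q] = c * c ^ q], and conjugation by [q] fixes [c ^+ k.+1]. So
    [c ^+ k.+2] is a product of only [k.+1] commutators. *)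
Lemma commutator_pow p q k : commute q ([~ p, q] ^+ k.+1) ->
  [~ p, q * q] * ([~ p, q] ^ q) ^+ k = [~ p, q] ^+ k.+2.
Proof.
move=> qc; have -> : [~ p, q * q] = [~ p, q] * [~ p, q] ^ q.
  by rewrite /commg /conjg !gnorm.
rewrite -conjXg -mulgA -conjMg -expgS [RHS]expgS; congr (_ * _).
exact/conjg_fixP/commgP/commute_sym.
Qed.

(* In T, the double centralizer of {x, z}, there are few commutators and each has a
   power commuting with q, so [commutator_pow] lets [bounded_words] apply to them. *)
Lemma commutator_torsion n x z : few n x -> few n z ->
  exists o, [/\ 0 < o, o <= torsion_bound n & [~ x, z] ^+ o = 1].
Proof.
move=> nx nz; pose T := double_centralizer [set y | y = x \/ y = z].
have Tconj p g h : T p -> x ^ g = x ^ h -> z ^ g = z ^ h -> p ^ g = p ^ h.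
  by move=> Tp xgh zgh; apply: double_centralizer_conj Tp => y [] ->.
have TM p q : T p -> T q -> T (p * q) by apply: double_centralizerM.
have TV p : T p -> T p^-1 by apply: double_centralizerV.
have TJ p q : T p -> T q -> T (p ^ q) by move=> Tp Tq; apply: (TM _ _ (TV _ Tq)); apply: TM.
have TR p q : T p -> T q -> T [~ p, q].
  by move=> *; rewrite commgEl; apply: TM; [apply: TV|apply: TJ].
have nxz : bounded (n * n) (range (fun g => (x ^ g, z ^ g))).
  apply: bounded_sub (bounded_image2 pair nx nz) => _ [g _ <-].
  by exists (x ^ g); [exists g|exists (z ^ g) => //; exists g].
pose D := [set [~ p, q] | p in T & q in T].
have bD : bounded (n * n * (n * n)) D.
  pose f (pq : G * G) := ((x ^ pq.1, z ^ pq.1), (x ^ pq.2, z ^ pq.2)).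
  apply: bounded_sub (@bounded_factor _ _ _ f (fun pq => [~ pq.1, pq.2]) _
    [set pq | T pq.1 /\ T pq.2] _ _) => [_ [p Tp [q Tq <-]]||].
  - by exists (p, q).
  - move=> [p q] [p' q'] /= [Tp Tq] [Tp' Tq'] [xp zp xq zq].
    (* [[~ p, q] = p^-1 * p ^ q] sees [q] only through its action on [x] and [z]; inverting the
       commutator gives the same for [p]. *)
    rewrite !commgEl (Tconj p q q')// -!commgEl -invgR -[RHS]invgR.
    by rewrite !commgEl (Tconj q' p p').
  apply: bounded_sub (bounded_image2 pair nxz nxz) => _ [[p q] _ <-].
  by exists (x ^ p, z ^ p); [exists p|exists (x ^ q, z ^ q) => //; exists q].
have DJ c d : D c -> D d -> D (c ^ d).
  move=> [p Tp [q Tq <-]] [p' Tp' [q' Tq' <-]]; rewrite conjRg.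
  by exists (p ^ [~ p', q']); [|exists (q ^ [~ p', q'])] => //; apply: TJ => //; apply: TR.
have Dpow c : D c -> exists w, [/\ {in w, forall y, D y}, size w <= n * n &
    \prod_(y <- w) y = c ^+ (n * n).+1].
  move=> [p Tp [q Tq <-]]; set c0 := [~ p, q].
  (* Two powers of [c0] act alike on [x] and [z], hence on [q], so [q] commutes with
     [c0 ^+ (j - i)]. *)
  have [|i [j [ij jn [xij zij]]]] :=
      @bounded_pigeonhole _ (fun i => (x ^ (c0 ^+ i), z ^ (c0 ^+ i))) (n * n).
    by apply: bounded_sub nxz => _ [i _ <-]; exists (c0 ^+ i).
  have Tc : T c0 by apply: TR.
  have := Tconj q _ _ Tq (esym xij) (esym zij).
  move=> /conj_eqP; rewrite -expgnFr 1?ltnW//.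
  have [k -> kn] : exists2 k, (j - i = k.+1)%N & k < n * n.
    by exists (j - i).-1; lia.
  (* The copies of [c0] in front pad the exponent to [(n * n).+1] and the length to [n * n]. *)
  move=> qc; exists (nseq (n * n - k.+1) c0 ++ [~ p, q * q] :: nseq k (c0 ^ q)).
  split.
  - move=> y; rewrite mem_cat inE !mem_nseq.
    move=> /orP[/andP[_ /eqP->]|/predU1P[->|/andP[_ /eqP->]]].
    + by exists p => //; exists q.
    + by exists p => //; exists (q * q) => //; apply: TM.
    + rewrite conjRg; exists (p ^ q); first exact: TJ.
      by exists (q ^ q) => //; apply: TJ.
  - by rewrite size_cat /= !size_nseq; lia.
  rewrite big_cat big_cons /= !prod_nseq commutator_pow// -expgnDr.
  by congr (_ ^+ _); lia.
have Dxz : D [~ x, z].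
  by exists x; [|exists z] => //; apply: double_centralizer_sub; [left|right].
(* Powers of [[~ x, z]] are words over [D], so two of them coincide. *)
have [|i [j [ij jM cij]]] :=
    @bounded_pigeonhole _ (fun i => [~ x, z] ^+ i) (torsion_bound n).
  apply: bounded_sub (bounded_words bD DJ Dpow) => _ [i _ <-].
  exists (nseq i [~ x, z]); last by rewrite prod_nseq.
  by move=> y; rewrite mem_nseq => /andP[_ /eqP->].
exists (j - i)%N; split; first by rewrite subn_gt0.
  by rewrite (leq_trans (leq_subr _ _)).
by rewrite expgnFr 1?ltnW// cij mulgV.
Qed.

(** * Generated subgroups and their commutators *)

Lemma is_subgroupP (H : set G) :
  is_subgroup H <-> H 1 /\ forall x y, H x -> H y -> H (x * y^-1).
Proof.
split=> -[H1 HB]; split; [exact/set_mem| |exact/mem_set|].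
  by move=> x y Hx Hy; apply/set_mem/HB; apply/mem_set.
by move=> x y /set_mem Hx /set_mem Hy; apply/mem_set/HB.
Qed.

Lemma generated_subgroup (Y : set G) : is_subgroup (generated Y).
Proof.
apply/is_subgroupP; split=> [H [/is_subgroupP[]]//|x y Yx Yy H HY].
by have [/is_subgroupP[_ HB] _] := HY; apply: HB; [apply: Yx|apply: Yy].
Qed.

Lemma subgroupV (H : set G) x : is_subgroup H -> H x -> H x^-1.
Proof. by move=> /is_subgroupP[H1 HB] Hx; rewrite -[x^-1]mul1g; apply: HB. Qed.

Lemma subgroupM (H : set G) x y : is_subgroup H -> H x -> H y -> H (x * y).
Proof.
move=> sH Hx Hy; rewrite -[y]invgK.
by have /is_subgroupP[_ HB] := sH; apply: HB => //; apply: subgroupV.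
Qed.

Lemma generated_words (Y : set G) : (forall y, Y y -> Y y^-1) ->
  generated Y `<=` [set \prod_(x <- w) x | w in [set w | {in w, forall x, Y x}]].
Proof.
move=> YV; apply: smallest_sub => [|y Yy]; last first.
  by exists [:: y]; rewrite ?big_seq1// => x; rewrite inE => /eqP->.
apply/is_subgroupP; split; first by exists [::]; rewrite ?big_nil.
move=> _ _ [v Yv <-] [w Yw <-].
exists (v ++ rev [seq x^-1 | x <- w]).
  move=> x; rewrite mem_cat mem_rev => /orP[/Yv//|/mapP[y yw ->]].
  exact/YV/Yw.
rewrite big_cat /=; congr (_ * _); elim: w {Yw} => [|x w IH].
  by rewrite !big_nil invg1.
by rewrite /= rev_cons big_rcons /= IH big_cons invgM.
Qed.

Lemma generated_conj (Y : set G) : (forall y g, Y y -> Y (y ^ g)) ->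
  forall x g, generated Y x -> generated Y (x ^ g).
Proof.
move=> YJ x g; move: x; apply: smallest_sub => [|y Yy]; last first.
  by apply: sub_gen_smallest; apply: YJ.
have /is_subgroupP[Y1 YB] := generated_subgroup Y.
apply/is_subgroupP; split=> [|x y Yx Yy]; first by rewrite conj1g.
by rewrite conjMg conjVg; apply: YB.
Qed.

(** As [P] is normal, this set is the preimage of the centralizer of the image of [Y] modulo [P]. *)
Lemma commutators_subgroup P (Y : set G) : is_subgroup P ->
  (forall x g, P x -> P (x ^ g)) ->
  is_subgroup [set h | forall y, Y y -> P [~ y, h]].
Proof.
move=> sP PJ; apply/is_subgroupP; split=> [y _|h k Ph Pk y Yy].
  by rewrite commg1; have /is_subgroupP[] := sP.
have -> : [~ y, h * k^-1] = ([~ y, k]^-1 * [~ y, h]) ^ k^-1.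
  by rewrite /commg /conjg !gnorm.
by apply/PJ/(subgroupM sP _ (Ph y Yy))/(subgroupV sP)/Pk.
Qed.

Lemma commutator_subgroup_generated (Y : set G) :
  (forall y g, Y y -> Y (y ^ g)) ->
  commutator_subgroup (generated Y) `<=`
    generated [set [~ x, y] | x in Y & y in Y].
Proof.
move=> YJ; set P := generated [set _ | _ in _ & _ in _].
have sP : is_subgroup P by apply: generated_subgroup.
have PJ x g : P x -> P (x ^ g).
  apply: generated_conj => c h [y Yy [z Yz <-]]; rewrite conjRg.
  by exists (y ^ h); [apply: YJ|exists (z ^ h) => //; apply: YJ].
apply: smallest_sub => // _ [x Yx [y Yy <-]]; move: y Yy x Yx.
(* Extends the second argument from a set to the subgroup it generates; applied twice, with [invgR]
   swapping the arguments in between. *)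
have comm Z1 Z2 : (forall z h, Z1 z -> Z2 h -> P [~ z, h]) ->
    forall h, generated Z2 h -> forall z, Z1 z -> P [~ z, h].
  move=> PZ; apply: smallest_sub; first exact: commutators_subgroup.
  by move=> h Z2h z Z1z; apply: PZ.
apply: (comm) => x y Yx Yy; rewrite -invgR; apply: (subgroupV sP).
apply: comm Yx y Yy => x' y' Yx' Yy'.
by apply: sub_gen_smallest; exists x' => //; exists y'.
Qed.

(** * Few conjugates and few commutators *)

Lemma few_conj n x g : few n x -> few n (x ^ g).
Proof.
by apply: bounded_sub => _ [h _ <-]; rewrite -conjgM; exists (g * h).
Qed.

Lemma few_conjugates n K : (forall x, K x -> few n x) ->
  forall x, conjugates K x -> few n x.
Proof. by move=> nK _ [y Ky [g _ <-]]; apply/few_conj/nK. Qed.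

Lemma conjugates_conj K x g : conjugates K x -> conjugates K (x ^ g).
Proof.
by move=> [y Ky [h _ <-]]; exists y => //; exists (h * g); rewrite ?conjgM.
Qed.

Lemma few_inv n x : few n x -> few n x^-1.
Proof.
move=> /(bounded_image (fun y => y^-1)); apply: bounded_sub => _ [h _ <-].
by exists (x ^ h); [exists h|rewrite conjVg].
Qed.

Lemma few_mul n m x y : few n x -> few m y -> few (n * m) (x * y).
Proof.
move=> nx my; apply: bounded_sub (bounded_image2 (@mul G) nx my) => _ [h _ <-].
by exists (x ^ h); [exists h|exists (y ^ h); [exists h|rewrite conjMg]].
Qed.

(** [N ^ N] counts representatives [y] of [K] by their action on [bs], [N * N] the values
    [[~ u, z]], [N] the values [[~ y, z]], and the last [N * N] the conjugates of one commutator. *)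
Definition commutator_bound N := (N ^ N * (N * N * N) * (N * N))%N.

(* Maximality of the number of conjugates a^b forces every conjugate of u * a by X
   into {u * a^b | b in bs}, which confines [u, z] to the quotients a^b / a^z. *)
Lemma bounded_centralizing_commutators K X N a (bs : seq G) :
  few N a -> {in bs, forall b, X b} -> uniq [seq a ^ b | b <- bs] ->
  (forall x (cs : seq G), K x -> {in cs, forall c, X c} ->
    uniq [seq x ^ c | c <- cs] -> size cs <= size bs) ->
  bounded (N * N)
    [set [~ u, z] | u in [set u | K (u * a) /\ {in bs, forall b, commute b u}] & z in X].
Proof.
move=> Na Xbs ubs bsmax.
have := bounded_image2 (fun y z => y * z^-1) Na Na.
apply: bounded_sub => _ [u [Kua bu] [z Xz <-]].
have uab b : b \in bs -> (u * a) ^ b = u * a ^ b.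
  by move=> bbs; rewrite conjMg; congr (_ * _); apply/conjg_fixP/commgP/commute_sym/bu.
have : (u * a) ^ z \in [seq (u * a) ^ b | b <- bs].
  apply: contraT => zbs.
  have /bsmax-/(_ _ Kua) : {in z :: bs, forall c, X c} by move=> c /predU1P[->//|/Xbs].
  rewrite /= zbs ltnn; apply.
  have -> : [seq (u * a) ^ b | b <- bs] = map (mul u) [seq a ^ b | b <- bs].
    by rewrite -map_comp; apply/eq_in_map => b /uab.
  by rewrite map_inj_uniq//; apply: mulgI.
move=> /mapP[b bbs]; rewrite (uab b bbs) conjMg => uaz.
exists (a ^ b); first by exists b.
exists (a ^ z); first by exists z.
by rewrite commgEl -[u ^ z](mulgK (a ^ z)) uaz -(mulgA u) mulKg.
Qed.

Lemma bounded_commutators K N : is_subgroup K -> (forall x, K x -> few N x) ->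
  bounded (commutator_bound N)
    [set [~ x, z] | x in conjugates K & z in conjugates K].
Proof.
move=> sK NK; pose X := conjugates K.
have NX := few_conjugates NK; have XJ := @conjugates_conj K.
have KX : K `<=` X by move=> x Kx; exists x => //; exists 1; rewrite ?conjg1.
have K1 : K 1 by have /is_subgroupP[] := sK.
pose attained k := `[< exists a (bs : seq G), [/\ K a, {in bs, forall b, X b},
  uniq [seq a ^ b | b <- bs] & size bs = k] >].
have att0 : exists k, attained k by exists 0%N; apply/asboolP; exists 1, [::].
have attN k : attained k -> k <= N.
  move=> /asboolP[a [bs [Ka _ ubs <-]]]; have [s [sN as_]] := NK a Ka.
  rewrite (leq_trans _ sN)// -(size_map (conjg a)); apply: uniq_leq_size => // y.
  by move=> /mapP[b _ ->]; apply: as_; exists b.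
have [k /asboolP[a [bs [Ka Xbs ubs sbs]]] kmax] := ex_maxnP att0 attN.
have N0 : 0 < N.
  have [[|y s] [sN s1]] := NK 1 K1; last exact: leq_trans sN.
  by have := s1 1 (ex_intro2 _ _ 1 I (conj1g 1)).
have kN : size bs <= N by rewrite sbs attN//; apply/asboolP; exists a, bs.
(* If [x] and [y] conjugate every [b] in [bs] alike, then [x * y^-1] centralizes [bs]. *)
have /bounded_reps[r [rN rK Kr]] : bounded (N ^ N)%N [set [seq b ^ x | b <- bs] | x in K].
  apply: (@bounded_leq _ (N ^ size bs)%N); first by rewrite leq_pexp2l.
  have := @bounded_map _ _ _ (fun b x => b ^ x) N bs (fun b bbs => NX b (Xbs b bbs)).
  by apply: bounded_sub => _ [x _ <-]; exists x.
pose V := [set [~ u, z] | u in [set u | K (u * a) /\ {in bs, forall b, commute b u}] & z in X].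
have bV : bounded (N * N) V.
  apply: (bounded_centralizing_commutators (NK a Ka) Xbs ubs) => x cs Kx Xcs ucs.
  by rewrite sbs; apply: kmax; apply/asboolP; exists x, cs.
pose C y := [set [~ y, z] | z in X].
have bC y : K y -> bounded N (C y).
  move=> Ky; apply: bounded_sub (bounded_image (mul y^-1) (NK y Ky)) => _ [z _ <-].
  by exists (y ^ z) => //; exists z.
have bKX : bounded (N ^ N * (N * N * N)) [set [~ x, z] | x in K & z in X].
  have := @bounded_bigcup _ _ r _ _ (fun y => [set v ^ y * c | v in V & c in C y]) rN
     (fun y yr => bounded_image2 (fun v c => v ^ y * c) bV (bC y (rK y yr))).
  apply: bounded_sub => _ [x Kx [z Xz <-]].
  have [y yr xy] := Kr x Kx; have Ky := rK y yr; exists y => //.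
  (* With [u = x * y^-1]: [[~ u * y, z] = [~ u, z] ^ y * [~ y, z]]. *)
  exists [~ x * y^-1, z]; last exists [~ y, z].
  - exists (x * y^-1); last by exists z.
    split; last by move=> b bbs; apply/conj_eqP; move/eq_in_map: xy => ->.
    by apply: subgroupM => //; apply: subgroupM => //; apply: subgroupV.
  - by exists z.
  - by rewrite /commg /conjg !gnorm.
have /(@bounded_reps G G id) : bounded (N ^ N * (N * N * N))
    [set id x | x in [set [~ x, z] | x in K & z in X]].
  by apply: bounded_sub bKX => _ [x ? <-].
move=> [r' [r'N r'KX KXr']].
(* [[~ x ^ g, z] = [~ x, z ^ g^-1] ^ g] reduces the first argument to [K]. *)
apply: bounded_sub (@bounded_bigcup G G r' _ (N * N) (@conj_class G) r'N _).
  move=> _ [_ [x Kx [g _ <-]] [z Xz <-]].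
  have [|v vr' xzv] := KXr' [~ x, z ^ g^-1].
    by exists x => //; exists (z ^ g^-1) => //; apply: XJ.
  by exists v => //; exists g => //; rewrite -xzv conjRg conjgKV.
move=> _ /r'KX[x /KX Xx [z Xz <-]].
apply: bounded_sub (bounded_image2 (fun x z => [~ x, z]) (NX x Xx) (NX z Xz)).
move=> _ [g _ <-]; rewrite conjRg.
by exists (x ^ g); [exists g|exists (z ^ g) => //; exists g].
Qed.

(** * Bounding the commutator subgroup *)

Definition derived_bound N :=
  ((commutator_bound N).+1 ^ (commutator_bound N * torsion_bound N))%N.

Lemma bounded_derived K N : is_subgroup K -> (forall x, K x -> few N x) ->
  bounded (derived_bound N) (commutator_subgroup (generated (conjugates K))).
Proof.
move=> sK NK; set X := conjugates K.
have NX := few_conjugates NK; have XJ := @conjugates_conj K.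
apply: bounded_sub (commutator_subgroup_generated XJ) _.
set S := [set _ | _ in X & _ in X].
have SJ c g : S c -> S (c ^ g).
  move=> [x Xx [z Xz <-]]; rewrite conjRg.
  by exists (x ^ g); [apply: XJ|exists (z ^ g) => //; apply: XJ].
have SV c : S c -> S c^-1.
  by move=> [x Xx [z Xz <-]]; rewrite invgR; exists z => //; exists x.
apply: bounded_sub (generated_words SV) _.
apply: bounded_words; [exact: bounded_commutators|by move=> c d Sc _; apply: SJ|].
move=> c Sc; have [o [o0 oN co]] : exists o, [/\ 0 < o, o <= torsion_bound N & c ^+ o = 1].
  by case: Sc => x Xx [z Xz <-]; apply: commutator_torsion; apply: NX.
(* Dropping [o] letters keeps the product because [c ^+ o = 1]; [0 < o] makes the word short
   enough. *)
exists (nseq ((torsion_bound N).+1 - o) c); split.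
- by move=> y; rewrite mem_nseq => /andP[_ /eqP->].
- by rewrite size_nseq; lia.
- by rewrite prod_nseq expgnFr ?co ?invg1 ?mulg1 1?leqW.
Qed.

(** * From an approximate subgroup to a subgroup *)

(** [Q] absorbs right multiplication by [A], since [b * a = e * c] with [e] in [E], so it contains
    [generated A]. Conjugates of [w] in [W] are determined by those of at most [K] elements [e]; the
    factor [a] contributes [n]. *)
Lemma approximate_subgroup_few (K n : nat) (A : set G) : 0 < n ->
  approximate_subgroup K A -> (forall a, A a -> few n a) ->
  forall g, generated A g -> few ((n * n * n) ^ K * n) g.
Proof.
move=> n0 [symA [E [/bounded_card_le[s [sK Es]] AAE]]] nA.
have AV a : A a -> A a^-1 by move=> Aa; rewrite symA; exists a.
(* Keeps every [e = b * a * c^-1] with [a], [b], [c] in [A], and bounds the classes of all that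
   remain. *)
pose s' := [seq e <- s | `[< few (n * n * n) e >]].
pose W := double_centralizer [set e | e \in s'].
pose Q := [set w * a | w in W & a in [set a | A a \/ a = 1]].
have W1 : W 1 by move=> c _; apply/commute_sym/commute1.
have QA q a : Q q -> A a -> Q (q * a).
  move=> [w Ww [b [Ab|->] <-]] Aa; last by rewrite mulg1; exists w => //; exists a => //; left.
  have [e Ee [c Ac ecab]] : set_mul E A (b * a) by apply: AAE; exists b => //; exists a.
  exists (w * e); last by exists c; [left|rewrite -mulgA ecab mulgA].
  apply: double_centralizerM => //; apply: double_centralizer_sub.
  rewrite /= mem_filter Es// andbT; apply/asboolP.
  have -> : e = b * a * c^-1 by rewrite -ecab mulgK.
  by apply: few_mul; [apply: few_mul|apply: few_inv]; apply: nA.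
(* Treating [g] and [g^-1] together makes the set of such [g] a subgroup. *)
have Qgen g : generated A g -> forall q, Q q -> Q (q * g) /\ Q (q * g^-1).
  move: g; apply: smallest_sub => [|a Aa q Qq]; last by split; apply: QA => //; apply: AV.
  apply/is_subgroupP; split=> [q Qq|g h Qg Qh q Qq]; first by rewrite invg1 mulg1.
  rewrite invgM invgK !mulgA; split; first by apply: (Qh _ (Qg _ Qq).1).2.
  by apply: (Qg _ (Qh _ Qq).1).2.
move=> g Ag; have Q1 : Q 1 by exists 1 => //; exists 1; [right|rewrite mulg1].
have [w Ww [a Aa <-]] : Q g by rewrite -[g]mul1g; apply: (Qgen g Ag 1 Q1).1.
have na : few n a.
  case: Aa => [/nA//|->]; exists [:: 1]; split=> // _ [h _ <-].
  by rewrite conj1g mem_head.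
pose f h := [seq e ^ h | e <- s'].
apply: few_mul na.
apply: (@bounded_factor _ _ _ f) => [h k _ _ fhk|].
  by apply: double_centralizer_conj Ww => e es'; move/eq_in_map: fhk; apply.
apply: (@bounded_leq _ ((n * n * n) ^ size s')%N).
  by rewrite leq_pexp2l ?muln_gt0 ?n0// size_filter (leq_trans (count_size _ _)).
by apply: bounded_map => e; rewrite mem_filter => /andP[/asboolP].
Qed.

End Groups.

Theorem theorem1p1 :
  exists f : nat -> nat -> nat,
    forall (K n : nat) (G : groupType) (A : set G),
      (0 < K)%N -> (0 < n)%N ->
      approximate_subgroup K A ->
      (forall a : G, A a -> (conj_class a #<= `I_n)%card) ->
      (commutator_subgroup (generated (conjugates A)) #<= `I_(f K n))%card.
Proof.
exists (fun K n => derived_bound ((n * n * n) ^ K * n)%N) => K n G A _ n0 appA nA.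
apply/bounded_card_le.
have few_gen := approximate_subgroup_few n0 appA (fun a Aa => (bounded_card_le _ _).2 (nA a Aa)).
apply: bounded_sub (bounded_derived (generated_subgroup A) few_gen).
(* Passing from [A] to [generated A] can only enlarge the commutator subgroup to be bounded. *)
have sub : generated (conjugates A) `<=` generated (conjugates (generated A)).
  apply: sub_smallest2r; first exact: generated_subgroup.
  move=> _ [a Aa [g _ <-]].
  by exists a; [apply: sub_gen_smallest|exists g].
apply: sub_smallest2r; first exact: generated_subgroup.
move=> _ [x Hx [y Hy <-]].
by exists x; [apply: sub|exists y => //; apply: sub].
Qed.
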